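(* Let $\Delta,\nu$ be positive integers. Consider the finite simple graphs $G$ with no isolated vertices such that $\Delta(G)=\Delta$, $\nu(G)=\nu$ and $$|E(G)|=\Delta\nu+\left\lfloor\frac{\nu}{\lceil\Delta/2\rceil}\right\rfloor\left\lfloor\frac{\Delta}{2}\right\rfloor.$$ Such a graph $G$ is unique up to isomorphism if and only if $\lceil\Delta/2\rceil$ divides $\nu$ or $\nu=1$.
   Context: All graphs are finite and simple. $\Delta(G)$ is the maximum degree of $G$, $\nu(G)$ the size of a maximum matching, $E(G)$ the edge set. *)

(* Defs.v *)
From mathcomp Require Import all_boot.

Set Implicit Arguments.
Unset Strict Implicit.
Unset Printing Implicit Defensive.

Record sgraph := SGraph {
  vertex :> finType;
  adj : rel vertex;
  adj_sym : symmetric adj;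
  adj_irrefl : irreflexive adj }.

Definition edges (G : sgraph) : {set {set G}} :=
  [set [set x; y] | x in G, y in G & adj x y].

Definition degree (G : sgraph) (x : G) : nat := #|[set y | adj x y]|.

Definition max_degree (G : sgraph) : nat := \max_(x : G) degree x.

Definition no_isolated (G : sgraph) : Prop := forall x : G, exists y : G, adj x y.

Definition is_matching (G : sgraph) (M : {set {set G}}) : bool :=
  (M \subset edges G) && trivIset M.

Definition matching_number (G : sgraph) : nat :=
  \max_(M : {set {set G}} | is_matching M) #|M|.

Definition isomorphic (G H : sgraph) : Prop :=
  exists2 f : G -> H, bijective f & forall x y, adj (f x) (f y) = adj x y.

Definition unique_up_to_iso (P : sgraph -> Prop) : Prop :=
  exists2 G, P G & forall H, P H -> isomorphic G H.

(* [uphalf Delta] and [Delta./2] are the ceiling and floor of Delta / 2. *)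
Definition extremal_size (Delta nu : nat) : nat :=
  Delta * nu + (nu %/ uphalf Delta) * Delta./2.

Definition extremal (Delta nu : nat) (G : sgraph) : Prop :=
  [/\ no_isolated G, max_degree G = Delta, matching_number G = nu
    & #|edges G| = extremal_size Delta nu].

(* Main.v *)
(** Gallai's lemma gives the structure. If no vertex is covered by all maximum
    matchings, then "u = v, or no maximum matching misses both u and v" is an
    equivalence relation containing adjacency; its classes C have odd size and
    each contributes (|C| - 1) / 2 edges to a maximum matching. Put
    k = ceil (Delta / 2). A class spans at most Delta (|C| - 1) / 2 edges, plus
    floor (Delta / 2) when (|C| - 1) / 2 >= k. Deleting a vertex covered by all
    maximum matchings costs at most Delta edges and lowers nu, so induction
    bounds the number of edges by the extremal size.

    If k divides nu, equality forces every class to have 2k + 1 vertices and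
    the largest possible degree sum, hence to be K_(2k+1), or for odd Delta > 1
    the complement of P_3 + (k - 1) K_2. If nu = 1 < k, the graph is a star.
    Otherwise write nu = q k + r with 0 < r < k: q extremal classes and r stars
    form an extremal graph, and there is another one with a different number of
    vertices, obtained by replacing the r >= 2 stars with K_(r,Delta), or, when
    r = 1, a class and the star with a nearly Delta-regular graph on 2k + 3
    vertices (for Delta = 3, the star with a triangle). *)

Require Import Defs.
From mathcomp Require Import all_boot zify.

Set Implicit Arguments.
Unset Strict Implicit.
Unset Printing Implicit Defensive.

Lemma edgesP (G : sgraph) (e : {set G}) :
  reflect (exists x y, adj x y /\ e = [set x; y]) (e \in edges G).
Proof.
apply: (iffP imset2P) => [[x y _ + ->]|[x [y [xy ->]]]].
  by rewrite inE => /andP[_ xy]; exists x, y.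
by exists x y; rewrite // inE xy.
Qed.

Lemma adj_neq (G : sgraph) (x y : G) : adj x y -> x != y.
Proof. by apply: contraTneq => ->; rewrite adj_irrefl. Qed.

Lemma edges_pair (G : sgraph) (x y : G) : ([set x; y] \in edges G) = adj x y.
Proof.
apply/edgesP/idP => [[a [b [ab /setP E]]]|xy]; last by exists x, y.
have ab' := adj_neq ab.
move: (E x) (E y) (E a) (E b); rewrite !inE !eqxx ?orbT /=.
move=> /esym/orP[]/eqP-> /esym/orP[]/eqP->; rewrite // ?orbb ?(negPf ab') //.
- by rewrite eq_sym (negPf ab').
- by rewrite adj_sym.
Qed.

Lemma card_edge (G : sgraph) (e : {set G}) : e \in edges G -> #|e| = 2.
Proof. by case/edgesP => x [y [/adj_neq xy ->]]; rewrite cards2 xy. Qed.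

Lemma handshake (G : sgraph) : \sum_(x : G) degree x = #|edges G|.*2.
Proof.
have deg (x : G) : degree x = \sum_(e in edges G) (x \in e).
  rewrite -big_mkcondr sum1_card /=.
  rewrite /degree -(card_in_imset (f := fun y => [set x; y])) => [|y z].
    apply: eq_card => e; rewrite [RHS]inE; apply/imsetP/andP => [[y]|[+ xe]].
      by rewrite inE => xy ->; rewrite edges_pair xy !inE eqxx.
    case/edgesP => a [b [ab E]]; move: xe; rewrite E !inE => /orP[]/eqP->.
      by exists b; rewrite ?inE.
    by exists a; rewrite ?inE 1?adj_sym // setUC.
  rewrite !inE => xy xz /setP/(_ y); rewrite !inE eqxx orbT eq_sym.
  by rewrite (negPf (adj_neq xy)) /= => /esym/eqP.
under eq_bigr => x _ do rewrite deg.
rewrite exchange_big /= -mul2n mulnC -sum_nat_const; apply: eq_bigr => e eG.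
rewrite -(card_edge eG) -sum1_card [RHS]big_mkcond.
by apply: eq_bigr => x _; case: (x \in e).
Qed.

(** * Gallai's lemma *)

Section Matchings.
Variable G : sgraph.
Implicit Types (M N : {set {set G}}) (x y : G).

Lemma matching_size M : is_matching M -> #|M| <= matching_number G.
Proof. by move=> mM; rewrite /matching_number (bigmax_sup M). Qed.

Lemma matching_card_cover M : is_matching M -> #|cover M| = #|M|.*2.
Proof.
case/andP => /subsetP ME /eqP <-; rewrite -mul2n mulnC -sum_nat_const.
by apply: eq_bigr => e /ME/card_edge.
Qed.

Lemma matching_mate M x : is_matching M -> x \in cover M ->
  exists y, [/\ adj x y, [set x; y] \in M & y \in cover M].
Proof.
case/andP => /subsetP ME _ /bigcupP[e eM xe].
have /edgesP[a [b [ab E]]] := ME e eM; move: xe eM; rewrite {e}E !inE.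
case/orP => /eqP -> eM; [exists b | exists a]; split => //; last 2 first.
- by rewrite setUC.
- by apply/bigcupP; exists [set a; b]; rewrite ?inE ?eqxx.
- by apply/bigcupP; exists [set a; b]; rewrite ?inE ?eqxx ?orbT.
- by rewrite adj_sym.
Qed.

Lemma matching_add M x y : is_matching M -> adj x y ->
    x \notin cover M -> y \notin cover M ->
  is_matching ([set x; y] |: M) /\ #|[set x; y] |: M| = #|M|.+1.
Proof.
move=> /andP[ME tM] xy xM yM.
have dis : {in M, forall B : {set G}, [disjoint [set x; y] & B]}.
  move=> B BM; rewrite disjoints_subset subUset !sub1set !inE.
  apply/andP; split; [apply: contra xM | apply: contra yM] => ?;
    by apply/bigcupP; exists B.
have M0 : set0 \notin M.
  by apply/negP => /(subsetP ME)/card_edge; rewrite cards0.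
have [tN nM] := trivIsetU1 dis tM M0.
by rewrite /is_matching cardsU1 nM subUset sub1set edges_pair xy ME.
Qed.

Lemma matching_del M e : is_matching M -> is_matching (M :\ e).
Proof.
case/andP => ME tM; rewrite /is_matching (trivIsetS _ tM) ?subD1set //.
by rewrite (subset_trans _ ME) ?subD1set.
Qed.

Lemma matching0 : is_matching (set0 : {set {set G}}).
Proof. by rewrite /is_matching sub0set; apply/trivIsetP => A B; rewrite inE. Qed.

Definition max_matching M := is_matching M && (#|M| == matching_number G).

Lemma ex_max_matching : exists M, max_matching M.
Proof.
have [|M mM E] := @eq_bigmax_cond _ (@is_matching G) (fun M => #|M|).
  by apply/card_gt0P; exists set0; apply: matching0.
by exists M; rewrite /max_matching; apply/andP; split=> //; rewrite -E.
Qed.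

Lemma max_matching_adj M x y : max_matching M -> adj x y ->
  (x \in cover M) || (y \in cover M).
Proof.
case/andP => mM /eqP sM xy; apply/negPn; rewrite negb_or; apply/negP => /andP[xM yM].
have [/matching_size] := matching_add mM xy xM yM.
by move=> + E; rewrite E sM ltnn.
Qed.

(* The heart of Gallai's lemma: a maximum matching N missing t and sharing as
   many edges as possible with M could be switched to share one more. *)
Lemma missing_trans t u v M : u != v -> max_matching M ->
    u \notin cover M -> v \notin cover M ->
    (exists2 N, max_matching N & t \notin cover N) ->
    (forall N, max_matching N -> (u \in cover N) || (t \in cover N)) ->
    (forall N, max_matching N -> (t \in cover N) || (v \in cover N)) -> False.
Proof.
move=> uv MM uM vM [N0 N0max tN0] Rut Rtv.
pose Q := fun N => max_matching N && (t \notin cover N).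
have QN0 : Q N0 by rewrite /Q N0max.
case: (arg_maxnP (fun N => #|M :&: N|) QN0) => N /andP[Nmax tN] Nbest.
have uN : u \in cover N by have := Rut N Nmax; rewrite (negPf tN) orbF.
have vN : v \in cover N by have := Rtv N Nmax; rewrite (negPf tN).
have [mM /eqP sM] := andP MM; have [mN /eqP sN] := andP Nmax.
have card_diff : #|cover M :\: cover N| = #|cover N :\: cover M|.
  rewrite !cardsD setIC (matching_card_cover mM) (matching_card_cover mN).
  by rewrite sM sN.
have : 1 < #|cover M :\: cover N|.
  rewrite card_diff -[2]/(true.+1) -uv -cards2; apply: subset_leq_card.
  by rewrite subUset !sub1set !inE uM vM uN vN.
rewrite (cardsD1 t) => lt1.
have /card_gt0P[x] : 0 < #|(cover M :\: cover N) :\ t|.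
  by rewrite -ltnS (leq_trans lt1) // -add1n leq_add2r leq_b1.
rewrite !inE => /and3P[xt xN xM].
have [y [xy xyM yM]] := matching_mate mM xM.
have yN : y \in cover N by have := max_matching_adj Nmax xy; rewrite (negPf xN).
have [z [yz yzN zN]] := matching_mate mN yN.
have yzM : [set y; z] \notin M.
  apply/negP => yzM; have /andP[_ /trivIsetP tM] := mM.
  have E : [set y; z] = [set x; y].
    apply/eqP/negPn/negP => /(tM _ _ yzM xyM); rewrite disjoints_subset subUset.
    by rewrite !sub1set !inE eqxx orbT.
  move: xN; apply/negP; rewrite negbK; apply/bigcupP; exists [set y; z] => //.
  by rewrite E !inE eqxx.
have cD : cover (N :\ [set y; z]) = cover N :\: [set y; z].
  by apply: coverD1 => //; case/andP: mN.
have [||mN' sN'] := matching_add (matching_del [set y; z] mN) xy.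
- by rewrite cD inE (negPf xN) andbF.
- by rewrite cD !inE eqxx.
set N' := _ |: _ in mN' sN'.
have QN' : Q N'.
  rewrite /Q /max_matching mN' sN' -sN (cardsD1 [set y; z] N) yzN eqxx /=.
  rewrite /N' /cover bigcup_setU big_set1 !inE -/(cover _) cD inE (negPf tN).
  rewrite andbF orbF negb_or eq_sym xt.
  by apply: contraNneq tN => ->.
have /= := Nbest N' QN'; rewrite leqNgt => /negP; apply; apply: proper_card.
apply/properP; split.
  apply/subsetP => e; rewrite !inE => /andP[eM eN]; rewrite eM eN andbT /=.
  by rewrite orbC; apply/orP; left; apply: contraNneq yzM => <-.
exists [set x; y]; first by rewrite !inE xyM eqxx.
rewrite inE xyM; apply: contra xN => xyN; apply/bigcupP.
by exists [set x; y]; rewrite ?inE ?eqxx.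
Qed.

Definition inessential := forall v : G, exists2 N, max_matching N & v \notin cover N.

Definition never_both u v :=
  (u == v) || [forall M, max_matching M ==> (u \in cover M) || (v \in cover M)].

Lemma never_bothP u v : reflect
  (u = v \/ forall M, max_matching M -> (u \in cover M) || (v \in cover M))
  (never_both u v).
Proof.
apply: (iffP orP) => [[/eqP|/forallP H]|[->|H]]; [by left| | by left|].
  by right=> M; apply/implyP.
by right; apply/forallP => M; apply/implyP/H.
Qed.

Lemma never_both_sym u v : never_both u v = never_both v u.
Proof.
by apply/never_bothP/never_bothP => -[->|H]; (try by left); right=> M /H; rewrite orbC.
Qed.

Lemma never_both_trans : inessential -> transitive never_both.
Proof.
move=> iG t u v /never_bothP[->//|Rut] /never_bothP[<-|Rtv]; apply/never_bothP.
  by right.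
case: (eqVneq u v) => [->|uv]; [by left | right => M MM].
apply/negPn; rewrite negb_or; apply/negP => /andP[uM vM].
exact: (missing_trans uv MM uM vM (iG t) Rut Rtv).
Qed.

Lemma never_both_equiv : inessential ->
  {in [set: G] & &, equivalence_rel never_both}.
Proof.
move=> iG x y z _ _ _; split=> [|xy]; first by rewrite /never_both eqxx.
apply/idP/idP; apply: never_both_trans => //; by rewrite never_both_sym.
Qed.

Definition closed_under_adj (C : {set G}) := forall x y, x \in C -> adj x y -> y \in C.

Lemma closed_cover_even M C : is_matching M -> closed_under_adj C ->
  ~~ odd #|C :&: cover M|.
Proof.
move=> mM cC; have [ME tM] := andP mM.
have in_or_out e : e \in M -> {in e, forall x, x \in C -> e \subset C}.
  move=> eM x; have /edgesP[a [b [ab ->]]] := subsetP ME _ eM.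
  rewrite !inE => /orP[]/eqP-> aC; rewrite subUset !sub1set aC ?andbT /=.
    exact: cC aC ab.
  by apply: cC aC _; rewrite adj_sym.
pose MC := [set e in M | e \subset C].
have mMC : is_matching MC.
  have sMC : MC \subset M by apply/subsetP => e; rewrite inE => /andP[].
  by rewrite /is_matching (subset_trans sMC ME) (trivIsetS sMC tM).
suff -> : C :&: cover M = cover MC by rewrite matching_card_cover ?odd_double.
apply/setP => x; rewrite !inE; apply/andP/bigcupP => [[xC /bigcupP[e eM xe]]|[e]].
  by exists e; rewrite // inE eM (in_or_out e eM x).
rewrite inE => /andP[eM /subsetP eC] xe; split; first exact: eC.
by apply/bigcupP; exists e.
Qed.

Lemma gallai : inessential -> exists P,
  [/\ partition P [set: G], forall C, C \in P -> closed_under_adj C,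
      forall C, C \in P -> odd #|C|
    & \sum_(C in P) #|C|./2 = matching_number G].
Proof.
move=> iG; have eqR := never_both_equiv iG.
pose P := equivalence_partition never_both [set: G].
have partP : partition P [set: G] := equivalence_partitionP eqR.
have [/eqP covP tP P0] := and3P partP.
have mem_class C x : C \in P -> x \in C -> forall y, (y \in C) = never_both x y.
  move=> CP xC y; rewrite -(pblock_equivalence_partition eqR) ?inE //.
  by rewrite (def_pblock tP CP xC).
have adjR x y : adj x y -> never_both x y.
  by move=> xy; apply/never_bothP; right=> M MM; apply: max_matching_adj.
have clP C : C \in P -> closed_under_adj C.
  by move=> CP x y xC /adjR; rewrite (mem_class C x).
have miss C M : C \in P -> max_matching M -> #|C :\: cover M| <= 1.
  move=> CP MM; apply/card_le1_eqP => x y; rewrite !inE => /andP[xM xC] /andP[yM yC].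
  move: yC; rewrite (mem_class C x) // => /never_bothP[//|/(_ M MM)].
  by rewrite (negPf xM) (negPf yM).
have oddP C : C \in P -> odd #|C|.
  move=> CP; have /set0Pn[x xC] : C != set0 by apply: contraNneq P0 => <-.
  have [M MM xM] := iG x; have /andP[mM _] := MM.
  have := closed_cover_even mM (clP C CP).
  have : 0 < #|C :\: cover M| by apply/card_gt0P; exists x; rewrite !inE xM.
  by have := miss C M CP MM; have := cardsID (cover M) C; lia.
exists P; split => //.
have [M MM] := ex_max_matching; have /andP[mM /eqP <-] := MM.
apply: double_inj; rewrite -(matching_card_cover mM).
have -> : cover M = [set x in cover P | x \in cover M].
  by apply/setP => x; rewrite covP !inE.
rewrite -sum1_card (eq_bigl (fun x => (x \in cover P) && (x \in cover M))); last first.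
  by move=> x; rewrite inE.
rewrite big_mkcondr big_trivIset //= -muln2 big_distrl /=; apply: eq_bigr => C CP.
rewrite -big_mkcondr sum1_card.
have -> : #|[pred x in C | x \in cover M]| = #|C :&: cover M|.
  by apply: eq_card => x; rewrite !inE.
have := closed_cover_even mM (clP C CP); have := oddP C CP.
by have := miss C M CP MM; have := cardsID (cover M) C; lia.
Qed.

End Matchings.

(** * The edge bound *)

Section Restriction.
Variables (G : sgraph) (A : {set G}).

Definition restrict_adj : rel G := fun x y => [&& adj x y, x \in A & y \in A].

Lemma restrict_adj_sym : symmetric restrict_adj.
Proof. by move=> x y; rewrite /restrict_adj adj_sym [(x \in A) && _]andbC. Qed.

Lemma restrict_adj_irrefl : irreflexive restrict_adj.
Proof. by move=> x; rewrite /restrict_adj adj_irrefl. Qed.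

(* The vertices outside A are kept, as isolated vertices. *)
Definition restrict := SGraph restrict_adj_sym restrict_adj_irrefl.

Lemma degree_restrict (x : G) : @degree restrict x <= degree x.
Proof. by apply: subset_leq_card; apply/subsetP => y; rewrite !inE => /and3P[]. Qed.

Lemma restrict_edges : edges restrict \subset edges G.
Proof.
apply/subsetP => e /edgesP[x [y [/and3P[xy _ _] ->]]].
by apply/edgesP; exists x, y.
Qed.

Lemma restrict_cover_sub (M : {set {set G}}) :
  M \subset edges restrict -> cover M \subset A.
Proof.
move=> /subsetP ME; apply/bigcupsP => e /ME/edgesP[x [y [/and3P[_ xA yA] ->]]].
by rewrite subUset !sub1set xA.
Qed.

Lemma closed_degree_sum_even : closed_under_adj A ->
  ~~ odd (\sum_(x in A) degree x).
Proof.
move=> cA; suff -> : \sum_(x in A) degree x = #|edges restrict|.*2.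
  by rewrite odd_double.
rewrite -handshake [LHS]big_mkcond /=; apply: eq_bigr => x _.
case: ifPn => [xA|xA]; last first.
  apply/esym/eqP; rewrite cards_eq0 -subset0; apply/subsetP => y.
  by rewrite inE => /and3P[_]; rewrite (negPf xA).
apply: eq_card => y; rewrite !inE /= /restrict_adj xA /=.
by case xy: (adj x y) => //=; rewrite (cA x y xA xy).
Qed.

End Restriction.

Lemma closed_degree (G : sgraph) (C : {set G}) x :
  closed_under_adj C -> x \in C -> degree x <= #|C|.-1.
Proof.
move=> cC xC; rewrite (cardsD1 x C) xC /=; apply: subset_leq_card.
apply/subsetP => y; rewrite !inE => xy; rewrite (cC x y) // andbT eq_sym.
exact: adj_neq xy.
Qed.

Lemma edges_delete (G : sgraph) (v : G) :
  #|edges G| <= degree v + #|edges (restrict [set~ v])|.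
Proof.
apply: leq_trans (leq_add (leq_imset_card (fun y => [set v; y]) _) (leqnn _)).
apply: leq_trans (leq_card_setU _ _); apply: subset_leq_card; apply/subsetP => e.
case/edgesP => x [y [xy ->]]; rewrite inE.
have [<-|xv] := eqVneq x v.
  by apply/orP; left; apply/imsetP; exists y; rewrite ?inE.
have [<-|yv] := eqVneq y v.
  by apply/orP; left; apply/imsetP; exists x; rewrite ?inE 1?adj_sym // setUC.
apply/orP; right; apply/(@edgesP (restrict [set~ v])); exists x, y; split=> //=.
by rewrite /restrict_adj xy !inE xv yv.
Qed.

Lemma matching_number_delete (G : sgraph) (v : G) :
    (forall N, max_matching N -> v \in cover N) ->
  matching_number (restrict [set~ v]) < matching_number G.
Proof.
move=> ev; have [M /andP[/andP[ME tM] /eqP sM]] := ex_max_matching (restrict [set~ v]).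
have vM : v \notin cover M.
  have /subsetP/(_ v) := @restrict_cover_sub G _ _ ME.
  by rewrite !inE eqxx; case: (v \in cover M) => // /(_ isT).
have mM : @is_matching G M.
  by rewrite /is_matching tM (subset_trans ME) ?restrict_edges.
rewrite -sM ltn_neqAle; apply/andP; split; last exact: (matching_size mM).
by apply: contra vM => sM'; apply: ev; apply/andP.
Qed.

Lemma inessential_dec (G : sgraph) :
  inessential G \/ exists v : G, forall N, max_matching N -> v \in cover N.
Proof.
have [/existsP[v /forallP ev]|/existsPn nev] :=
  boolP [exists v : G, forall N, max_matching N ==> (v \in cover N)].
  by right; exists v => N; apply/implyP.
left=> v; have /forallPn[N] := nev v; rewrite negb_imply => /andP[? ?].
by exists N.
Qed.

Lemma extremal_size_step Delta n :
  Delta + extremal_size Delta n <= extremal_size Delta n.+1.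
Proof.
rewrite /extremal_size mulnS -addnA !leq_add2l leq_mul2r leq_div2r ?orbT //.
Qed.

Section EdgeBound.
Variables (Delta : nat) (G : sgraph) (P : {set {set G}}).
Hypothesis Delta_gt0 : 0 < Delta.
Hypothesis degG : forall x : G, degree x <= Delta.
Hypothesis partP : partition P [set: G].
Hypothesis closedP : forall C, C \in P -> closed_under_adj C.
Hypothesis oddP : forall C, C \in P -> odd #|C|.

Let k := uphalf Delta.

Definition class_bound (C : {set G}) :=
  (Delta * #|C|./2 + (k <= #|C|./2) * Delta./2).*2.

Lemma class_degree_sum C : C \in P -> \sum_(x in C) degree x <= class_bound C.
Proof.
move=> CP; rewrite /class_bound.
have oC := oddP CP; have eS := closed_degree_sum_even (closedP CP).
have le1 : \sum_(x in C) degree x <= #|C| * Delta.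
  by rewrite -sum_nat_const; apply: leq_sum => x _.
have le2 : \sum_(x in C) degree x <= #|C| * #|C|.-1.
  by rewrite -sum_nat_const; apply: leq_sum => x xC; apply: closed_degree (closedP CP) xC.
set S := \sum_(x in C) _ in eS le1 le2 *.
have kE : k = uphalf Delta by [].
have cE : #|C| = #|C|./2.*2.+1 by lia.
move: le1 le2; rewrite {1 2 3}cE; set m := #|C|./2; rewrite succnK => le1 le2.
case: (leqP k m) => km; last by nia.
have dE : Delta = odd Delta + Delta./2.*2 by lia.
have : S < (Delta * m + Delta./2).*2.+2 by nia.
rewrite mul1n; lia.
Qed.

Lemma edges_by_classes : #|edges G|.*2 = \sum_(C in P) \sum_(x in C) degree x.
Proof.
rewrite -handshake -(set_partition_big _ partP).
by apply: eq_bigl => x; rewrite inE.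
Qed.

Definition large := [set C in P | k <= #|C|./2].

Lemma class_bound_sum : \sum_(C in P) class_bound C =
  (Delta * (\sum_(C in P) #|C|./2) + #|large| * Delta./2).*2.
Proof.
rewrite /class_bound -(big_morph double doubleD double0) big_split /= -big_distrr /=.
congr (_ + _).*2; rewrite -big_distrl /= -big_mkcondr sum1_card.
by congr (_ * _); apply: eq_card => C; rewrite !inE.
Qed.

Lemma large_le : #|large| * k <= \sum_(C in P) #|C|./2.
Proof.
rewrite -sum_nat_const; apply: leq_trans (_ : \sum_(C in large) #|C|./2 <= _).
  by apply: leq_sum => C; rewrite inE => /andP[].
by rewrite [X in _ <= X](big_setID large) /= (setIidPr _) ?leq_addr //;
  apply/subsetP => C; rewrite inE => /andP[].
Qed.

Lemma edge_bound_classes : #|edges G| <= extremal_size Delta (\sum_(C in P) #|C|./2).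
Proof.
rewrite -leq_double edges_by_classes.
apply: leq_trans (leq_sum _ class_degree_sum) _.
rewrite class_bound_sum leq_double leq_add2l leq_mul2r leq_divRL ?large_le ?orbT //.
rewrite uphalf_half; lia.
Qed.

Lemma extremal_classes q : no_isolated G -> 1 < Delta ->
    \sum_(C in P) #|C|./2 = q * k -> #|edges G| = extremal_size Delta (q * k) ->
  #|P| = q /\ forall C, C \in P ->
    #|C| = k.*2.+1 /\ \sum_(x in C) degree x = (Delta * k + Delta./2).*2.
Proof.
move=> isoG Delta_gt1 sumP sizeG.
have k_gt0 : 0 < k by rewrite /k uphalf_half; lia.
have size2 : #|edges G|.*2 = (Delta * (q * k) + q * Delta./2).*2.
  by rewrite sizeG /extremal_size mulnK.
have : \sum_(C in P) \sum_(x in C) degree x <= \sum_(C in P) class_bound C.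
  by apply: leq_sum => C; apply: class_degree_sum.
rewrite -edges_by_classes class_bound_sum.
rewrite size2 sumP leq_double leq_add2l leq_pmul2r; last by lia.
move=> le_q; have := large_le; rewrite sumP leq_pmul2r // => ge_q.
have {le_q ge_q} card_large : #|large| = q by lia.
have large_sub : large \subset P by apply/subsetP => C; rewrite inE => /andP[].
have : \sum_(C in large) #|C|./2 + \sum_(C in P :\: large) #|C|./2
    = \sum_(C in large) k.
  by rewrite sum_nat_const card_large -sumP [RHS](big_setID large) /= (setIidPr large_sub).
have le_large C : C \in large -> k <= #|C|./2 ?= iff (k == #|C|./2).
  by rewrite inE => /andP[_ kC]; split.
have [le_sum eq_sum] := leqif_sum le_large => sumE.
have small0 : \sum_(C in P :\: large) #|C|./2 = 0 by lia.
have /forall_inP large_k : [forall (C | C \in large), k == #|C|./2].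
  by rewrite -eq_sum; apply/eqP; lia.
have P_large : P = large.
  apply/eqP; rewrite eqEsubset large_sub andbT; apply/subsetP => C CP.
  apply/negPn/negP => CL.
  move/eqP: small0; rewrite sum_nat_eq0 => /forall_inP/(_ C).
  rewrite inE CL CP => /(_ isT)/eqP C0.
  have /cards1P[x Cx] : #|C| == 1 by have := oddP CP; lia.
  have [y xy] := isoG x; have := closedP CP _ xy; rewrite Cx !inE eqxx => /(_ isT).
  by rewrite eq_sym (negPf (adj_neq xy)).
split=> [|C CP]; first by rewrite P_large.
have CL : C \in large by rewrite -P_large.
have /eqP kC := large_k C CL.
split; first by have := oddP CP; lia.
have le_class D : D \in P ->
    \sum_(x in D) degree x <= class_bound D ?= iff (\sum_(x in D) degree x == class_bound D).
  by move=> DP; split=> //; apply: class_degree_sum.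
have [_ eq_class] := leqif_sum le_class.
have /forall_inP/(_ C CP)/eqP -> :
    [forall (D | D \in P), \sum_(x in D) degree x == class_bound D].
  rewrite -eq_class -edges_by_classes class_bound_sum size2 sumP card_large.
  by rewrite eqxx.
by rewrite /class_bound -kC leqnn mul1n.
Qed.

End EdgeBound.

Lemma edge_bound Delta (G : sgraph) n : 0 < Delta ->
    (forall x : G, degree x <= Delta) -> matching_number G <= n ->
  #|edges G| <= extremal_size Delta n.
Proof.
move=> Delta_gt0; elim: n G => [|n IH] G degG nuG.
all: have [iG|[v ev]] := inessential_dec G.
- have [P [partP clP oddP sumP]] := gallai iG.
  have -> : 0 = matching_number G by lia.
  by rewrite -sumP edge_bound_classes.
- by have := matching_number_delete ev; lia.
- have [P [partP clP oddP sumP]] := gallai iG.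
  apply: leq_trans (edge_bound_classes Delta_gt0 degG partP clP oddP) _.
  rewrite sumP leq_add ?leq_mul ?leq_div2r //.
apply: leq_trans (edges_delete v) (leq_trans _ (extremal_size_step _ _)).
apply: leq_add => //; apply: IH => [x|].
  exact: leq_trans (degree_restrict _ _) _.
by have := matching_number_delete ev; lia.
Qed.

Lemma extremal_partition Delta q (G : sgraph) : 1 < Delta -> 0 < q ->
    (forall x : G, degree x <= Delta) -> no_isolated G ->
    matching_number G = q * uphalf Delta ->
    #|edges G| = extremal_size Delta (q * uphalf Delta) ->
  exists P : {set {set G}},
  [/\ partition P [set: G], forall C, C \in P -> closed_under_adj C, #|P| = q
    & forall C, C \in P -> #|C| = (uphalf Delta).*2.+1 /\
        \sum_(x in C) degree x = (Delta * uphalf Delta + Delta./2).*2].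
Proof.
move=> Delta_gt1 q_gt0 degG isoG nuG sizeG.
have k_gt0 : 0 < uphalf Delta by rewrite uphalf_half; lia.
have [iG|[v ev]] := inessential_dec G.
  have [P [partP clP oddP sumP]] := gallai iG; exists P.
  rewrite nuG in sumP.
  by have [] := extremal_classes (ltnW Delta_gt1) degG partP clP oddP isoG Delta_gt1 sumP sizeG.
have lt_nu := matching_number_delete ev.
have := edges_delete v; rewrite sizeG leqNgt => /negP[].
have nu_gt0 : 0 < q * uphalf Delta by rewrite muln_gt0 q_gt0.
have deg_del (x : restrict [set~ v]) : degree x <= Delta.
  exact: leq_trans (degree_restrict _ _) (degG x).
apply: leq_ltn_trans (leq_add (degG v)
  (@edge_bound Delta _ (q * uphalf Delta).-1 _ deg_del _)) _.
- exact: ltnW.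
- by lia.
rewrite /extremal_size mulnK //.
have -> : (q * uphalf Delta).-1 %/ uphalf Delta = q.-1.
  have -> : (q * uphalf Delta).-1 = q.-1 * uphalf Delta + (uphalf Delta).-1.
    by case: (q) q_gt0 => // q' _; rewrite mulSn /=; lia.
  by rewrite divnMDl // divn_small ?addn0 // prednK.
rewrite addnA -mulnS prednK // ltn_add2l ltn_pmul2r; first by rewrite prednK.
by rewrite half_gt0.
Qed.

(** * Constructions *)

Definition complete_adj n : rel 'I_n := fun x y => x != y.

Lemma complete_adj_sym n : symmetric (@complete_adj n).
Proof. by move=> x y; rewrite /complete_adj eq_sym. Qed.

Lemma complete_adj_irrefl n : irreflexive (@complete_adj n).
Proof. by move=> x; rewrite /complete_adj eqxx. Qed.

Definition complete n := SGraph (@complete_adj_sym n) (@complete_adj_irrefl n).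

Definition compl_rel (T : eqType) (r : rel T) : rel T := fun x y => (x != y) && ~~ r x y.

Lemma compl_rel_sym (T : eqType) (r : rel T) : symmetric r -> symmetric (compl_rel r).
Proof. by move=> rs x y; rewrite /compl_rel eq_sym rs. Qed.

Lemma compl_rel_irrefl (T : eqType) (r : rel T) : irreflexive (compl_rel r).
Proof. by move=> x; rewrite /compl_rel eqxx. Qed.

Definition gcompl (G : sgraph) :=
  SGraph (compl_rel_sym (@adj_sym G)) (compl_rel_irrefl (@adj G)).

Section Union.
Variables G H : sgraph.

Definition union_adj : rel (G + H) := fun u v =>
  match u, v with
  | inl x, inl y => adj x y
  | inr x, inr y => adj x y
  | _, _ => false
  end.

Lemma union_adj_sym : symmetric union_adj.
Proof. by move=> [x|x] [y|y] //=; apply: adj_sym. Qed.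

Lemma union_adj_irrefl : irreflexive union_adj.
Proof. by move=> [x|x] /=; apply: adj_irrefl. Qed.

Definition gunion := SGraph union_adj_sym union_adj_irrefl.

Lemma degree_inl (x : G) : @degree gunion (inl x) = degree x.
Proof.
rewrite /degree -(card_imset _ (@inl_inj G H)); apply: eq_card => v.
rewrite !inE; apply/idP/imsetP => [|[y + ->]]; last by rewrite inE.
by case: v => [y|y] //= xy; exists y; rewrite ?inE.
Qed.

Lemma degree_inr (x : H) : @degree gunion (inr x) = degree x.
Proof.
rewrite /degree -(card_imset _ (@inr_inj G H)); apply: eq_card => v.
rewrite !inE; apply/idP/imsetP => [|[y + ->]]; last by rewrite inE.
by case: v => [y|y] //= xy; exists y; rewrite ?inE.
Qed.

Lemma card_gunion : #|gunion| = #|G| + #|H|.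
Proof. exact: card_sum. Qed.

Lemma matching_number_gunion :
  matching_number gunion <= matching_number G + matching_number H.
Proof.
apply/bigmax_leqP => M /andP[/subsetP ME tM].
pose part (K : sgraph) (f : K -> gunion) := [set e in edges K | f @: e \in M].
have mpart (K : sgraph) (f : K -> gunion) : injective f -> is_matching (part K f).
  move=> f_inj; apply/andP; split; first by apply/subsetP => e; rewrite inE => /andP[].
  apply/trivIsetP => e1 e2; rewrite !inE => /andP[_ e1M] /andP[_ e2M] e12.
  rewrite -(imset_disjoint (f := f)) //.
  by apply: (trivIsetP tM) => //; rewrite (inj_eq (imset_inj f_inj)).
have sub : M \subset [set inl @: (e : {set G}) | e in part G inl]
                 :|: [set inr @: (e : {set H}) | e in part H inr].
  apply/subsetP => e eM; have /edgesP[u [v [uv E]]] := ME e eM; rewrite inE.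
  case: u v uv E => [x|x] [y|y] //= xy E; apply/orP; [left | right];
    apply/imsetP; exists [set x; y]; rewrite ?inE ?edges_pair ?xy /= imsetU !imset_set1 -?E //.
apply: leq_trans (subset_leq_card sub) (leq_trans (leq_card_setU _ _) _).
apply: leq_add; apply: leq_trans (leq_imset_card _ _) (matching_size (mpart _ _ _)).
  exact: inl_inj.
exact: inr_inj.
Qed.

End Union.

Definition copies n (G : sgraph) := iter n (gunion G) (complete 0).

Definition biclique m n := gcompl (gunion (complete m) (complete n)).

Lemma card_complete n : #|complete n| = n.
Proof. exact: card_ord. Qed.

Lemma card_gcompl (G : sgraph) : #|gcompl G| = #|G|.
Proof. by []. Qed.

Lemma card_copies n (G : sgraph) : #|copies n G| = n * #|G|.
Proof.
elim: n => [|n IH]; first by rewrite card_complete.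
by rewrite [copies _ _]/(gunion G (copies n G)) card_gunion IH mulSn.
Qed.

Lemma degree_complete n (x : complete n) : degree x = n.-1.
Proof.
rewrite /degree -[in RHS](card_complete n) -(cardC1 x).
by apply: eq_card => y; rewrite !inE /= eq_sym.
Qed.

Lemma degree_gcompl (G : sgraph) (x : G) : @degree (gcompl G) x + degree x = #|G|.-1.
Proof.
rewrite -(cardC1 x) -(cardID [pred y | adj x y] (predC1 x)) addnC; congr (_ + _).
  apply: eq_card => y; rewrite !inE; case xy: (adj x y); rewrite ?andbF ?andbT //.
  by rewrite eq_sym adj_neq.
by apply: eq_card => y; rewrite !inE /= /compl_rel eq_sym andbC.
Qed.

Definition degree_sum (G : sgraph) := \sum_(x : G) degree x.

Lemma degree_sum_complete n : degree_sum (complete n) = n * n.-1.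
Proof.
rewrite /degree_sum (eq_bigr (fun=> n.-1)) => [|x _]; last exact: degree_complete.
by rewrite sum_nat_const card_complete.
Qed.

Lemma degree_sum_gunion (G H : sgraph) : degree_sum (gunion G H) = degree_sum G + degree_sum H.
Proof.
rewrite /degree_sum big_sumType /=; congr (_ + _); apply: eq_bigr => x _.
  exact: degree_inl.
exact: degree_inr.
Qed.

Lemma degree_sum_gcompl (G : sgraph) : degree_sum (gcompl G) + degree_sum G = #|G| * #|G|.-1.
Proof.
rewrite -big_split /= -sum_nat_const; apply: eq_bigr => x _; exact: degree_gcompl.
Qed.

Lemma degree_sum_copies n (G : sgraph) : degree_sum (copies n G) = n * degree_sum G.
Proof.
elim: n => [|n IH]; first by rewrite degree_sum_complete.
by rewrite [copies _ _]/(gunion G (copies n G)) degree_sum_gunion IH mulSn.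
Qed.

Definition degrees_in a b (G : sgraph) := forall x : G, a <= degree x <= b.

Lemma degrees_in_complete n : degrees_in n.-1 n.-1 (complete n).
Proof. by move=> x; rewrite degree_complete leqnn. Qed.

Lemma degrees_in_gunion a b (G H : sgraph) :
  degrees_in a b G -> degrees_in a b H -> degrees_in a b (gunion G H).
Proof. by move=> dG dH [x|x]; rewrite ?degree_inl ?degree_inr. Qed.

Lemma degrees_in_copies a b n (G : sgraph) : degrees_in a b G -> degrees_in a b (copies n G).
Proof. by move=> dG; elim: n => [[]//|n IH]; apply: degrees_in_gunion. Qed.

Lemma degrees_in_gcompl a b (G : sgraph) :
  degrees_in a b G -> degrees_in (#|G|.-1 - b) (#|G|.-1 - a) (gcompl G).
Proof.
move=> dG x; have := dG x; rewrite -(@degree_gcompl G x) => /andP[dx dx'].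
by rewrite leq_subLR [b + _]addnC leq_add2l dx' -addnBA ?leq_addr.
Qed.

Lemma degrees_inW a b a' b' (G : sgraph) :
  degrees_in a b G -> a' <= a -> b <= b' -> degrees_in a' b' G.
Proof. by move=> dG aa bb x; have /andP[? ?] := dG x; apply/andP; split; lia. Qed.

Lemma degrees_in_no_isolated (G : sgraph) a b : 0 < a -> degrees_in a b G -> no_isolated G.
Proof.
move=> a_gt0 dG x; have /andP[+ _] := dG x => /(leq_trans a_gt0)/card_gt0P[y].
by rewrite inE; exists y.
Qed.

Definition fits Delta n e (G : sgraph) :=
  [/\ degrees_in 1 Delta G, matching_number G <= n & #|edges G| = e].

Lemma edges_degree_sum (G : sgraph) : #|edges G| = (degree_sum G)./2.
Proof. by rewrite /degree_sum handshake doubleK. Qed.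

Lemma fits_gunion Delta n1 n2 e1 e2 (G H : sgraph) :
  fits Delta n1 e1 G -> fits Delta n2 e2 H -> fits Delta (n1 + n2) (e1 + e2) (gunion G H).
Proof.
move=> [dG nG eG] [dH nH eH]; split; first exact: degrees_in_gunion.
  exact: leq_trans (matching_number_gunion _ _) (leq_add nG nH).
by apply: double_inj; rewrite -handshake -/(degree_sum _) degree_sum_gunion
  /degree_sum !handshake eG eH doubleD.
Qed.

Lemma matching_number_small n (G : sgraph) : #|G| <= n.*2.+1 -> matching_number G <= n.
Proof.
move=> cG; apply/bigmax_leqP => M /matching_card_cover cM.
by have := max_card (mem (cover M)); rewrite cM; lia.
Qed.

Lemma fits_small Delta n e (G : sgraph) : #|G| <= n.*2.+1 -> degrees_in 1 Delta G ->
  degree_sum G = e.*2 -> fits Delta n e G.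
Proof.
move=> cG dG eG; split=> //; first exact: matching_number_small.
by rewrite edges_degree_sum eG doubleK.
Qed.

Lemma fits_copies Delta n e q (G : sgraph) :
  fits Delta n e G -> fits Delta (q * n) (q * e) (copies q G).
Proof.
move=> fG; elim: q => [|q IH]; last by rewrite !mulSn; apply: fits_gunion.
by apply: fits_small; [rewrite card_complete | case | rewrite degree_sum_complete].
Qed.

Lemma matching_number_vertex_cover (G : sgraph) (A : {set G}) :
  (forall x y, adj x y -> (x \in A) || (y \in A)) -> matching_number G <= #|A|.
Proof.
move=> covA; apply/bigmax_leqP => M /andP[/subsetP ME tM].
have meets e : e \in M -> exists x, x \in e :&: A.
  move=> /ME/edgesP[x [y [/covA/orP[]xA ->]]]; [exists x | exists y];
    by rewrite !inE xA eqxx ?orbT.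
have tMA : trivIset [set e :&: A | e in M].
  apply/trivIsetP => _ _ /imsetP[e eM ->] /imsetP[f fM ->] ef.
  have {}ef : e != f by apply: contraNneq ef => ->.
  have := trivIsetP tM _ _ eM fM ef; rewrite -!setI_eq0 => /eqP d.
  by rewrite setIACA d set0I.
have inj : {in M &, injective (fun e => e :&: A)}.
  move=> e f eM fM E; apply/eqP/negPn/negP => ef.
  have [x xe] := meets e eM; have xf := xe; rewrite E in xf.
  have /pred0P/(_ x) := trivIsetP tM _ _ eM fM ef.
  by move: xe xf; rewrite !inE => /andP[-> _] /andP[->].
rewrite -(card_in_imset inj) -sum1_card.
apply: leq_trans (_ : #|cover [set e :&: A | e in M]| <= _).
  move/eqP: tMA => <-; apply: leq_sum => _ /imsetP[e eM ->].
  by have [x] := meets e eM; rewrite card_gt0 => xA; apply/set0Pn; exists x.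
by apply: subset_leq_card; apply/bigcupsP => _ /imsetP[e _ ->]; apply: subsetIr.
Qed.

Lemma fits_biclique Delta m : 0 < m <= Delta -> fits Delta m (m * Delta) (biclique m Delta).
Proof.
case/andP=> m_gt0 mD.
have dG : degrees_in 1 Delta (biclique m Delta).
  case=> x.
    have := @degree_gcompl (gunion (complete m) (complete Delta)) (inl x).
    rewrite degree_inl degree_complete card_gunion !card_complete -/(biclique m Delta).
    by lia.
  have := @degree_gcompl (gunion (complete m) (complete Delta)) (inr x).
  rewrite degree_inr degree_complete card_gunion !card_complete -/(biclique m Delta).
  by lia.
split=> //.
  have cA : #|[set (inl x : biclique m Delta) | x in complete m]| = m.
    by rewrite card_imset ?card_complete //; apply: inl_inj.
  rewrite -[X in _ <= X]cA; apply: matching_number_vertex_cover.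
  move=> [x|x] [y|y]; rewrite /= /compl_rel /= ?imset_f ?orbT //.
  by rewrite /complete_adj; case: (eqVneq x y) => [->|]; rewrite ?eqxx ?andbF.
rewrite edges_degree_sum.
have := degree_sum_gcompl (gunion (complete m) (complete Delta)).
rewrite degree_sum_gunion !degree_sum_complete card_gunion !card_complete -/(biclique m Delta).
move: (degree_sum _) => D.
case: m Delta m_gt0 mD {dG} => [//|m] [//|d] _ _ E.
suff -> : D = (m.+1 * d.+1).*2 by rewrite doubleK.
by move: E; rewrite addnS !succnK; nia.
Qed.

Lemma extremal_fits Delta nu (G : sgraph) : 0 < Delta -> 0 < nu ->
    (exists x : G, degree x = Delta) ->
  fits Delta nu (extremal_size Delta nu) G -> extremal Delta nu G.
Proof.
move=> D_gt0 nu_gt0 [x dx] [dG nG eG].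
have dG' (y : G) : degree y <= Delta by have /andP[] := dG y.
split=> //; first exact: degrees_in_no_isolated dG.
  apply/eqP; rewrite eqn_leq; apply/andP; split; first by apply/bigmax_leqP.
  by rewrite -dx; apply: (bigmax_sup x).
apply/eqP; rewrite eqn_leq nG leqNgt; apply/negP => lt_nu.
have := @edge_bound Delta G nu.-1 D_gt0 dG'; rewrite -ltnS prednK // => /(_ lt_nu).
rewrite eG; have := extremal_size_step Delta nu.-1; rewrite prednK //; lia.
Qed.

Lemma degree_sum_edges (G : sgraph) : degree_sum G = #|edges G|.*2.
Proof. exact: handshake. Qed.

Lemma degree_sum_regular d (G : sgraph) : degrees_in d d G -> degree_sum G = #|G| * d.
Proof.
move=> dG; rewrite -sum_nat_const; apply: eq_bigr => x _.
by have := dG x; lia.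
Qed.

Lemma dense_max_degree Delta n (G : sgraph) : #|G| <= n.*2.+1 -> 0 < Delta <= n.*2 ->
    degrees_in 1 Delta G -> degree_sum G = (Delta * n + Delta./2).*2 ->
  exists x : G, degree x = Delta.
Proof.
move=> cG /andP[D_gt0 Dn] dG sG.
have [/existsP[x /eqP dx]|/existsPn dlt] := boolP [exists x : G, degree x == Delta].
  by exists x.
suff : degree_sum G <= n.*2.+1 * Delta.-1 by rewrite sG; nia.
apply: leq_trans (leq_mul cG (leqnn _)); rewrite -sum_nat_const.
by apply: leq_sum => x _; have := dlt x; have := dG x; lia.
Qed.

Lemma ex_2regular n : 6 <= n -> exists Z, #|vertex Z| = n /\ degrees_in 2 2 Z.
Proof.
have K3 : #|complete 3| = 3 /\ degrees_in 2 2 (complete 3).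
  by rewrite card_complete; split=> //; apply: degrees_in_complete.
have C4 : #|biclique 2 2| = 4 /\ degrees_in 2 2 (biclique 2 2).
  have c4 : #|gunion (complete 2) (complete 2)| = 4 by rewrite card_gunion card_complete.
  split=> //; have := @degrees_in_gcompl 1 1 (gunion (complete 2) (complete 2)).
  by rewrite c4; apply; apply: degrees_in_gunion; apply: degrees_in_complete.
have add m G : #|vertex G| = m /\ degrees_in 2 2 G ->
    forall p, (exists Z, #|vertex Z| = p /\ degrees_in 2 2 Z) ->
    exists Z, #|vertex Z| = m + p /\ degrees_in 2 2 Z.
  move=> [cG dG] p [H [cH dH]]; exists (gunion G H).
  by rewrite card_gunion cG cH; split=> //; apply: degrees_in_gunion.
elim/ltn_ind: n => n IH n6.
have [n9|n9] := leqP 9 n.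
  have -> : n = 3 + (n - 3) by lia.
  by apply: (add _ _ K3); apply: IH; lia.
have : (n == 3 + 3) || (n == 3 + 4) || (n == 4 + 4) by lia.
case/orP => [/orP[]|] /eqP ->.
- by apply: (add _ _ K3); exists (complete 3).
- by apply: (add _ _ K3); exists (biclique 2 2).
- by apply: (add _ _ C4); exists (biclique 2 2).
Qed.

Lemma ex_3regular j : 2 <= j -> exists Z, #|vertex Z| = j.*2 /\ degrees_in 3 3 Z.
Proof.
elim/ltn_ind: j => j IH j2; have [j4|j4] := leqP 4 j.
  have [||Z [cZ dZ]] := IH (j - 2); [by lia.. |].
  exists (gunion (complete 4) Z); rewrite card_gunion card_complete cZ.
  by split; [lia | apply: degrees_in_gunion => //; apply: degrees_in_complete].
have /orP[] : (j == 2) || (j == 3) by lia.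
  move/eqP ->; exists (complete 4); rewrite card_complete.
  by split=> //; apply: degrees_in_complete.
move/eqP ->; exists (biclique 3 3).
have c6 : #|gunion (complete 3) (complete 3)| = 6 by rewrite card_gunion card_complete.
split=> //; have := @degrees_in_gcompl 2 2 (gunion (complete 3) (complete 3)).
by rewrite c6; apply; apply: degrees_in_gunion; apply: degrees_in_complete.
Qed.

(* For odd Delta the complement is the union of the wheel on five vertices
   (degrees 4, 3, 3, 3, 3) with a cubic graph. *)
Lemma ex_near_regular Delta : 3 < Delta -> exists X,
  [/\ #|vertex X| = (uphalf Delta).+1.*2.+1, degrees_in Delta.-1 Delta X
    & degree_sum X = (Delta * (uphalf Delta).+1 + Delta./2).*2].
Proof.
move=> D_gt3; set k := uphalf Delta.
have [oD|eD] := boolP (odd Delta); last first.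
  have kD : Delta = k.*2 by rewrite /k; lia.
  have [|Z [cZ dZ]] := @ex_2regular (k.+1.*2.+1); first by lia.
  exists (gcompl Z); split; first by rewrite card_gcompl cZ.
    by apply: (degrees_inW (degrees_in_gcompl dZ)); rewrite cZ; lia.
  have := degree_sum_gcompl Z; rewrite (degree_sum_regular dZ) cZ.
  rewrite kD doubleK; nia.
have kD : Delta = k.*2.-1 by rewrite /k; lia.
have [|Z [cZ dZ]] := @ex_3regular k.-1; first by lia.
pose B := gunion (complete 1) (copies 2 (complete 2)).
have cB : #|B| = 5 by rewrite card_gunion card_copies !card_complete.
have dB : degrees_in 0 1 B.
  apply: degrees_in_gunion; first by apply: degrees_inW (@degrees_in_complete 1) _ _.
  by apply: degrees_in_copies; apply: degrees_inW (@degrees_in_complete 2) _ _.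
have sB : degree_sum (gcompl B) = 16.
  have := degree_sum_gcompl B; rewrite cB degree_sum_gunion degree_sum_copies.
  by rewrite !degree_sum_complete; lia.
pose Y := gunion (gcompl B) Z.
have cY : #|Y| = k.+1.*2.+1 by rewrite card_gunion card_gcompl cB cZ; lia.
have dY : degrees_in 3 4 Y.
  apply: degrees_in_gunion; last by apply: degrees_inW dZ _ _.
  by apply: (degrees_inW (degrees_in_gcompl dB)); rewrite cB.
exists (gcompl Y); split; first by rewrite card_gcompl.
  by apply: (degrees_inW (degrees_in_gcompl dY)); rewrite cY; lia.
have := degree_sum_gcompl Y; rewrite cY degree_sum_gunion sB (degree_sum_regular dZ) cZ.
have hD : Delta./2 = k.-1 by rewrite /k; lia.
rewrite hD kD; have : 1 < k by lia.
case: (k) => [//|[//|k']] _; rewrite [k'.+2.*2]doubleS !succnK; nia.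
Qed.

(* The complement of P_3 + (k - 1) K_2 when Delta = 2k - 1. *)
Definition pattern Delta :=
  if odd Delta && (1 < Delta)
  then gcompl (gunion (biclique 1 2) (copies (uphalf Delta).-1 (complete 2)))
  else complete Delta.+1.

Lemma fits_pattern Delta : 0 < Delta ->
  fits Delta (uphalf Delta) (Delta * uphalf Delta + Delta./2) (pattern Delta) /\
  exists x : pattern Delta, degree x = Delta.
Proof.
move=> D_gt0; rewrite /pattern; set k := uphalf Delta.
case: ifPn => [/andP[oD D_gt1]|notodd]; last first.
  split; last by exists ord0; rewrite degree_complete.
  apply: fits_small.
  - by rewrite card_complete /k; lia.
  - by apply: degrees_inW (@degrees_in_complete _) _ _.
  - rewrite degree_sum_complete /=.
    have [oD|eD] := boolP (odd Delta).
      by rewrite /k; have -> : Delta = 1 by move: notodd; rewrite oD; lia.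
    have hD : Delta./2 = k by rewrite /k; lia.
    have kD : Delta = k.*2 by rewrite /k; lia.
    by rewrite hD kD; nia.
have kD : Delta = k.*2.-1 by rewrite /k; lia.
have hD : Delta./2 = k.-1 by rewrite /k; lia.
have k_gt1 : 1 < k by lia.
have [//|dP _ eP] := @fits_biclique 2 1.
set B := gunion _ _.
have cB : #|B| = k.*2.+1.
  rewrite card_gunion card_copies card_gcompl card_gunion !card_complete; lia.
have dB : degrees_in 1 2 B.
  apply: degrees_in_gunion => //; apply: degrees_in_copies.
  by apply: degrees_inW (@degrees_in_complete 2) _ _.
have dG : degrees_in 1 Delta (gcompl B).
  by apply: (degrees_inW (degrees_in_gcompl dB)); rewrite cB; lia.
have sG : degree_sum (gcompl B) = (Delta * k + Delta./2).*2.
  have := degree_sum_gcompl B; rewrite cB degree_sum_gunion degree_sum_copies.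
  rewrite degree_sum_complete (degree_sum_edges (biclique 1 2)) eP hD kD.
  case: (k) k_gt1 => [//|[//|k']] _; rewrite [k'.+2.*2]doubleS !succnK; nia.
have cG : #|gcompl B| <= k.*2.+1 by rewrite card_gcompl cB.
split; first exact: fits_small.
by apply: dense_max_degree cG _ dG sG; lia.
Qed.

(** * Uniqueness *)

Section Models.
Variable T : finType.
Implicit Types (r : rel T) (A B : {set T}).

Definition models (H : sgraph) r A := exists f : H -> T,
  [/\ injective f, f @: [set: H] = A & forall x y, r (f x) (f y) = adj x y].

Lemma models_eq H r r' A : {in A &, r =2 r'} -> models H r A -> models H r' A.
Proof.
move=> rr' [f [f_inj fA fr]]; exists f; split=> // x y.
by rewrite -fr rr' // -fA imset_f.
Qed.

Lemma models_gcompl H r A : models H r A -> models (gcompl H) (compl_rel r) A.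
Proof.
move=> [f [f_inj fA fr]]; exists f; split=> // x y.
by rewrite /compl_rel fr (inj_eq f_inj).
Qed.

Lemma models_gunion H1 H2 r A1 A2 : models H1 r A1 -> models H2 r A2 ->
    [disjoint A1 & A2] -> {in A1 & A2, forall x y, ~~ r x y && ~~ r y x} ->
  models (gunion H1 H2) r (A1 :|: A2).
Proof.
move=> [f [f_inj fA fr]] [g [g_inj gA gr]] dis no_r.
have fin x : f x \in A1 by rewrite -fA imset_f.
have gin x : g x \in A2 by rewrite -gA imset_f.
have fg x y : f x != g y.
  by apply/negP => /eqP E; have /pred0P/(_ (f x)) := dis; rewrite /= fin E gin.
exists (fun u => match u with inl x => f x | inr y => g y end); split.
- case=> x [] y; [by move/f_inj-> | by move/eqP; rewrite (negPf (fg _ _)) | | by move/g_inj->].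
  by move/eqP; rewrite eq_sym (negPf (fg _ _)).
- apply/setP => z; rewrite inE -fA -gA; apply/imsetP/orP.
    by case=> [[x|x] _ ->]; [left | right]; rewrite imset_f.
  by case=> /imsetP[x _ ->]; [exists (inl x) | exists (inr x)].
- case=> x [] y //=.
    by have /andP[/negPf] := no_r _ _ (fin x) (gin y).
  by have /andP[_ /negPf] := no_r _ _ (fin y) (gin x).
Qed.

Lemma models_complete r A : {in A &, forall x y, r x y = (x != y)} ->
  models (complete #|A|) r A.
Proof.
move=> rA; exists enum_val; split; first exact: enum_val_inj.
  apply/setP => x; apply/imsetP/idP => [[i _ ->]|xA]; first exact: enum_valP.
  by exists (enum_rank_in xA x); rewrite ?enum_rankK_in.
by move=> x y; rewrite rA ?enum_valP // (inj_eq enum_val_inj).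
Qed.

Lemma compl_relK r x y : irreflexive r -> compl_rel (compl_rel r) x y = r x y.
Proof.
by move=> ir; rewrite /compl_rel; case: eqVneq => [->|_] /=; rewrite ?ir ?negbK.
Qed.

Lemma models_star r c B : symmetric r -> irreflexive r -> c \notin B ->
    {in B, forall b, r c b} -> {in B &, forall b b', r b b' = false} ->
  models (biclique 1 #|B|) r (c |: B).
Proof.
move=> rs ri cB rc rB.
apply: models_eq (_ : models _ (compl_rel (compl_rel r)) _).
  by move=> x y _ _; apply: compl_relK.
apply/models_gcompl/models_gunion.
- rewrite -(cards1 c); apply: models_complete => x y /set1P-> /set1P->.
  by rewrite compl_rel_irrefl eqxx.
- by apply: models_complete => x y xB yB; rewrite /compl_rel rB ?andbT.
- by rewrite disjoints_subset sub1set inE.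
- by move=> x y /set1P-> yB; rewrite /compl_rel [r y c]rs (rc y yB) !andbF.
Qed.

Lemma models_matching r m (D : {set T}) : symmetric r -> irreflexive r -> #|D| = m.*2 ->
    {in D, forall x, #|[set y in D | r x y]| = 1} ->
  models (copies m (complete 2)) r D.
Proof.
move=> rs ri; elim: m D => [|m IH] D cD rD.
  have -> : D = set0 by apply/eqP; rewrite -cards_eq0 cD.
  by rewrite /copies /= -(cards0 T); apply: models_complete => x; rewrite inE.
have /card_gt0P[x xD] : 0 < #|D| by rewrite cD.
have /eqP/cards1P[y Ey] := rD x xD.
have in_x z : (z \in D) && r x z = (z == y) by rewrite -in_set1 -Ey inE.
have /andP[yD xy] : (y \in D) && r x y by rewrite in_x.
have /eqP/cards1P[x' Ex] := rD y yD.
have in_y z : (z \in D) && r y z = (z == x).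
  have : x \in [set x'] by rewrite -Ex inE xD rs.
  by rewrite inE => /eqP->; rewrite -in_set1 -Ex inE.
have nxy : x != y by apply: contraTneq xy => <-; rewrite ri.
have c2 : #|[set x; y]| = 2 by rewrite cards2 nxy.
have sub : [set x; y] \subset D by rewrite subUset !sub1set xD.
have no_r z w : z \in [set x; y] -> w \in D :\: [set x; y] -> ~~ r z w.
  rewrite !inE negb_or => zxy /andP[/andP[wx wy] wD]; apply/negP => zw.
  case/orP: zxy zw => /eqP-> zw.
    by have := in_x w; rewrite wD zw (negPf wy).
  by have := in_y w; rewrite wD zw (negPf wx).
rewrite -(setID D [set x; y]) (setIidPr sub).
apply: models_gunion.
- rewrite -[X in complete X]c2; apply: models_complete => a b.
  by rewrite !inE => /orP[]/eqP-> /orP[]/eqP->; rewrite ?ri ?eqxx // ?nxy // rs xy eq_sym nxy.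
- apply: IH => [|z zD]; first by rewrite cardsD (setIidPr sub) c2 cD; lia.
  have zD' : z \in D by move: zD; rewrite inE => /andP[].
  rewrite -(rD z zD'); apply: eq_card => w; rewrite !inE.
  case wD: (w \in D); rewrite ?andbF //= andbT; case zw: (r z w); rewrite ?andbF //= andbT.
  apply/negP => wxy; have := no_r w z; rewrite !inE in zD * => /(_ wxy zD).
  by rewrite rs zw.
- by rewrite disjoint_sym disjoints_subset subsetDr.
- move=> a b aA bB; rewrite no_r //= rs no_r //.
Qed.

End Models.

Lemma models_iso (G H : sgraph) : models H (@adj G) [set: G] -> isomorphic H G.
Proof.
move=> [f [f_inj fT fr]]; exists f => //; apply: inj_card_bij => //.
by rewrite -[#|G|]cardsT -fT card_imset // cardsT.
Qed.

Lemma models_copies (G H : sgraph) n (P : {set {set G}}) : #|P| = n -> trivIset P ->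
    (forall C, C \in P -> closed_under_adj C /\ models H (@adj G) C) ->
  models (copies n H) (@adj G) (cover P).
Proof.
elim: n P => [|n IH] P cP tP HP.
  have -> : P = set0 by apply/eqP; rewrite -cards_eq0 cP.
  rewrite /cover big_set0 /copies /= -(cards0 G).
  by apply: models_complete => x; rewrite inE.
have /card_gt0P[C CP] : 0 < #|P| by rewrite cP.
have [clC mC] := HP C CP.
have covE : cover P = C :|: cover (P :\ C).
  by rewrite -{1}(setD1K CP) /cover bigcup_setU big_set1.
have dis : [disjoint C & cover (P :\ C)].
  by rewrite coverD1 // disjoint_sym disjoints_subset subsetDr.
rewrite covE; apply: models_gunion => //.
  apply: IH; first by move: cP; rewrite (cardsD1 C) CP => -[].
    exact: trivIsetS (subD1set _ _) tP.
  by move=> D /setD1P[_ /HP].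
move=> x y xC yD; have yC : y \notin C.
  by apply/negP => yC; have /pred0P/(_ y) := dis; rewrite /= yC yD.
by rewrite [adj y x]adj_sym andbb; apply: contra yC; apply: clC.
Qed.

Lemma class_nonadj (G : sgraph) (C : {set G}) x : closed_under_adj C -> x \in C ->
  degree x + #|[set y in C | compl_rel (@adj G) x y]| = #|C|.-1.
Proof.
move=> clC xC; rewrite /degree (cardsD1 x C) xC add1n succnK.
rewrite -(cardsID [set y | adj x y] (C :\ x)).
congr (_ + _); apply: eq_card => y; rewrite !inE.
  case xy: (adj x y); rewrite ?andbF //= andbT (clC x y xC xy) andbT eq_sym.
  by rewrite (adj_neq xy).
by rewrite /compl_rel eq_sym; case: (y \in C); case: (y == x); case: (adj x y).
Qed.

Lemma class_models Delta (G : sgraph) (C : {set G}) : 1 < Delta ->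
    (forall x : G, degree x <= Delta) -> closed_under_adj C ->
    #|C| = (uphalf Delta).*2.+1 ->
    \sum_(x in C) degree x = (Delta * uphalf Delta + Delta./2).*2 ->
  models (pattern Delta) (@adj G) C.
Proof.
set k := uphalf Delta => D_gt1 degG clC cC sC.
pose r := compl_rel (@adj G); pose n x := #|[set y in C | r x y]|.
have rs : symmetric r := compl_rel_sym (@adj_sym G).
have ri : irreflexive r := compl_rel_irrefl (@adj G).
have nE x : x \in C -> degree x + n x = k.*2.
  by move=> xC; rewrite class_nonadj // cC.
have sn : (Delta * k + Delta./2).*2 + \sum_(x in C) n x = k.*2.+1 * k.*2.
  by rewrite -sC -big_split /= -cC -sum_nat_const; apply: eq_bigr.
rewrite /pattern D_gt1 andbT; case: ifPn => [oD|eD]; last first.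
  have kD : Delta = k.*2 by rewrite /k; lia.
  have hD : Delta./2 = k by rewrite /k; lia.
  have /eqP : \sum_(x in C) n x = 0 by move: sn; rewrite hD kD; nia.
  rewrite sum_nat_eq0 => /forall_inP n0.
  rewrite kD -cC; apply: models_complete => x y xC yC.
  have [->|xy] := eqVneq x y; first by rewrite adj_irrefl.
  have := n0 x xC; rewrite cards_eq0 => /eqP/setP/(_ y).
  by rewrite !inE yC /r /compl_rel xy /= => /negbFE.
have kD : Delta = k.*2.-1 by rewrite /k; lia.
have hD : Delta./2 = k.-1 by rewrite /k; lia.
have k_gt1 : 1 < k by lia.
have n_gt0 x : x \in C -> 0 < n x.
  by move=> xC; have := nE x xC; have := degG x; lia.
have /eqP/sum_nat_eq1[c [cinC nc n1]] : \sum_(x in C) (n x).-1 = 1.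
  have : \sum_(x in C) n x = \sum_(x in C) (n x).-1 + #|C|.
    rewrite -[#|C|]muln1 -sum_nat_const -big_split; apply: eq_bigr => x xC /=.
    by rewrite addn1 prednK ?n_gt0.
  move: sn; rewrite hD kD cC.
  case: (k) k_gt1 => [//|[//|k']] _; rewrite [k'.+2.*2]doubleS !succnK; nia.
pose B := [set y in C | r c y].
have cB : #|B| = 2 by rewrite -/(n c); lia.
have cNB : c \notin B by rewrite inE ri andbF.
have n_1 x : x \in C -> x != c -> n x = 1.
  by move=> xC xc; have := n1 x xc xC; have := n_gt0 x xC; lia.
have only_c b y : b \in B -> y \in C -> r b y -> y = c.
  rewrite inE => /andP[bC rcb] yC rby.
  have /eqP/cards1P[z Ez] : n b = 1.
    by apply: n_1 => //; apply: contraTneq rcb => ->; rewrite ri.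
  have : y \in [set z] by rewrite -Ez inE yC.
  have : c \in [set z] by rewrite -Ez inE cinC rs.
  by rewrite !inE => /eqP-> /eqP.
have subA : c |: B \subset C.
  by rewrite subUset sub1set cinC; apply/subsetP => y; rewrite inE => /andP[].
have mA : models (biclique 1 2) r (c |: B).
  rewrite -cB; apply: models_star => // [b|b b' bB b'B]; first by rewrite inE => /andP[].
  apply/negP => /only_c E; move: cNB; rewrite -(E bB) ?b'B //.
  by move: b'B; rewrite inE => /andP[].
have no_r x y : x \in c |: B -> y \in C :\: (c |: B) -> ~~ r x y.
  move=> xA; rewrite [y \in _]inE => /andP[yA yC]; apply: contra yA => rxy.
  case/setU1P: xA => [xc|xB]; first by rewrite !inE yC -xc rxy orbT.
  by rewrite (only_c x y) // !inE eqxx.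
have mD : models (copies k.-1 (complete 2)) r (C :\: (c |: B)).
  apply: models_matching => // [|x xD].
    by rewrite cardsD (setIidPr subA) cC cardsU1 cNB cB; lia.
  have [xA xC] : x \notin c |: B /\ x \in C by move: xD; rewrite inE => /andP[].
  rewrite -(n_1 x xC) => [|]; last by apply: contraNneq xA => ->; rewrite !inE eqxx.
  apply: eq_card => y; rewrite [LHS]inE [RHS]inE [y \in C :\: _]inE.
  case yC: (y \in C); rewrite ?andbF //= andbT.
  case rxy: (r x y); rewrite ?andbF //= andbT.
  by apply/negP => /no_r/(_ xD); rewrite rs rxy.
have mC : models (gunion (biclique 1 2) (copies k.-1 (complete 2))) r C.
  rewrite -(setID C (c |: B)) (setIidPr subA); apply: models_gunion => //.
    by rewrite disjoint_sym disjoints_subset subsetDr.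
  by move=> x y xA yD; rewrite [r y x]rs no_r.
apply: models_eq (models_gcompl mC) => x y _ _.
by apply: compl_relK; apply: adj_irrefl.
Qed.

Lemma max_degree_ge (G : sgraph) (x : G) : degree x <= max_degree G.
Proof. exact: (bigmax_sup x). Qed.

Lemma extremal_copies Delta q (G : sgraph) : 0 < Delta -> 0 < q ->
  extremal Delta (q * uphalf Delta) G -> isomorphic (copies q (pattern Delta)) G.
Proof.
move=> D_gt0 q_gt0 [isoG maxG nuG eG].
have degG (x : G) : degree x <= Delta by rewrite -maxG max_degree_ge.
apply: models_iso; have [D_gt1|D_le1] := ltnP 1 Delta.
  have [P [partP clP cP HP]] := extremal_partition D_gt1 q_gt0 degG isoG nuG eG.
  have [/eqP covP tP _] := and3P partP.
  rewrite -covP; apply: models_copies => // C CP; split; first exact: clP.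
  by have [cC sC] := HP C CP; apply: class_models => //; apply: clP.
have D1 : Delta = 1 by lia.
have deg1 (x : G) : degree x = 1.
  apply/eqP; rewrite eqn_leq -{1}D1 degG /=; have [y xy] := isoG x.
  by apply/card_gt0P; exists y; rewrite inE.
move: eG; rewrite D1 /extremal_size /= muln0 addn0 mul1n muln1 => eG.
apply: models_matching.
- exact: adj_sym.
- exact: adj_irrefl.
- rewrite cardsT -eG -handshake (eq_bigr (fun=> 1)) ?sum1_card // => x _; exact: deg1.
- by move=> x _; rewrite -[RHS](deg1 x); apply: eq_card => y; rewrite !inE.
Qed.

Lemma extremal_star Delta (G : sgraph) : 2 < Delta ->
  extremal Delta 1 G -> isomorphic (biclique 1 Delta) G.
Proof.
move=> D_gt2 [isoG maxG nuG]; rewrite /extremal_size divn_small ?muln1 ?addn0; last first.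
  by rewrite uphalf_half; lia.
move=> eG; have /card_gt0P[e] : 0 < #|edges G| by rewrite eG; lia.
case/edgesP => x0 _.
have [|c _ dc] := @eq_bigmax_cond G predT (@degree G).
  by apply/card_gt0P; exists x0.
have {}dc : degree c = Delta by rewrite -dc -maxG.
pose B := [set y | adj c y].
have cB : #|B| = Delta := dc.
have star : [set [set c; y] | y in B] = edges G.
  apply/eqP; rewrite eqEcard; apply/andP; split.
    by apply/subsetP => _ /imsetP[y + ->]; rewrite inE edges_pair.
  rewrite card_in_imset ?cB ?eG // => y z; rewrite !inE => cy cz /setP/(_ y).
  by rewrite !inE eqxx orbT eq_sym (negPf (adj_neq cy)) /= => /esym/eqP.
have adjE x y : adj x y -> (x == c) || (y == c).
  rewrite -edges_pair -star => /imsetP[z _ /setP/(_ c)].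
  by rewrite !inE eqxx /= ![c == _]eq_sym.
apply: models_iso; rewrite -cB.
have -> : [set: G] = c |: B.
  apply/setP => x; rewrite !inE; have [y xy] := isoG x; apply/esym.
  by case/orP: (adjE x y xy) => /eqP E; rewrite ?E ?eqxx // adj_sym -E xy orbT.
apply: models_star => //.
- exact: adj_sym.
- exact: adj_irrefl.
- by rewrite inE adj_irrefl.
- by move=> y; rewrite inE.
- move=> x y; rewrite !inE => /adj_neq cx /adj_neq cy; apply/negP => /adjE.
  by rewrite ![_ == c]eq_sym (negPf cx) (negPf cy).
Qed.

(** * Non-uniqueness *)

Lemma biclique_max_degree m n : 0 < m -> exists x : biclique m n, degree x = n.
Proof.
move=> m_gt0; exists (inl (Ordinal m_gt0)).
have := @degree_gcompl (gunion (complete m) (complete n)) (inl (Ordinal m_gt0)).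
rewrite degree_inl degree_complete card_gunion !card_complete -/(biclique m n).
by lia.
Qed.

Lemma isomorphic_card (G H : sgraph) : isomorphic G H -> #|G| = #|H|.
Proof. by case=> f /bij_eq_card. Qed.

Lemma unique_card (P : sgraph -> Prop) (G H : sgraph) :
  unique_up_to_iso P -> P G -> P H -> #|G| = #|H|.
Proof.
by move=> [U _ HU] /HU/isomorphic_card <- /HU/isomorphic_card.
Qed.

Lemma fits_extremal_size Delta q r n e (G : sgraph) : r < uphalf Delta ->
    n = q * uphalf Delta + r -> e = q * (Delta * uphalf Delta + Delta./2) + r * Delta ->
  fits Delta n e G -> fits Delta n (extremal_size Delta n) G.
Proof.
move=> lt_r nE eE [dG mG sG]; split=> //.
rewrite sG eE nE /extremal_size divnMDl ?(leq_ltn_trans _ lt_r) // divn_small // addn0.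
by move: (uphalf Delta) (Delta./2) => k h; nia.
Qed.

Lemma extremal_standard Delta q r (H : sgraph) : 0 < Delta -> 0 < q * uphalf Delta + r ->
    r < uphalf Delta -> fits Delta r (r * Delta) H ->
    (0 < q \/ exists x : H, degree x = Delta) ->
  extremal Delta (q * uphalf Delta + r) (gunion (copies q (pattern Delta)) H).
Proof.
move=> D_gt0 nu_gt0 lt_r fH ex_max; have [fP [p dp]] := fits_pattern D_gt0.
apply: extremal_fits => //.
  case: ex_max => [q_gt0|[x dx]]; last by exists (inr x); rewrite degree_inr.
  case: q q_gt0 {nu_gt0} => // q _; exists (inl (inl p)).
  by rewrite degree_inl (@degree_inl (pattern Delta)).
apply: (fits_extremal_size lt_r erefl erefl).
exact: fits_gunion (fits_copies q fP) fH.
Qed.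

Lemma extremal_not_unique Delta q r : 0 < Delta -> 0 < r < uphalf Delta ->
    1 < q * uphalf Delta + r ->
  ~ unique_up_to_iso (extremal Delta (q * uphalf Delta + r)).
Proof.
move=> D_gt0 /andP[r_gt0 lt_r] nu_gt1 uniq; set k := uphalf Delta in lt_r nu_gt1 uniq *.
have D_gt2 : 2 < Delta by move: lt_r; rewrite /k; lia.
have r_le : r <= Delta by move: lt_r; rewrite /k; lia.
have [star_max d_max] := @biclique_max_degree 1 Delta isT.
have fS : fits Delta 1 (1 * Delta) (biclique 1 Delta) by apply: fits_biclique.
have ex_copy : exists x : copies r (biclique 1 Delta), degree x = Delta.
  by case: r r_gt0 {lt_r nu_gt1 uniq r_le} => // r _; exists (inl star_max); rewrite degree_inl.
have ext1 : extremal Delta (q * k + r)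
    (gunion (copies q (pattern Delta)) (copies r (biclique 1 Delta))).
  apply: extremal_standard => //; first exact: ltnW.
    by have := fits_copies r fS; rewrite muln1 mul1n.
  by right.
have card1 : #|gunion (copies q (pattern Delta)) (copies r (biclique 1 Delta))|
    = q * #|pattern Delta| + r * Delta.+1.
  by rewrite card_gunion !card_copies card_gcompl card_gunion !card_complete.
have [r_gt1|r_le1] := ltnP 1 r.
  have ext2 : extremal Delta (q * k + r)
      (gunion (copies q (pattern Delta)) (biclique r Delta)).
    apply: extremal_standard => //; first exact: ltnW.
      by apply: fits_biclique; rewrite r_gt0.
    by right; apply: biclique_max_degree.
  have := unique_card uniq ext1 ext2; rewrite card1 !card_gunion card_copies.
  by rewrite !card_complete; nia.
have r1 : r = 1 by lia.
have q_gt0 : 0 < q by move: nu_gt1; rewrite r1; case: (q).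
rewrite r1 in ext1 card1 uniq lt_r nu_gt1.
have [D3|D_neq3] := eqVneq Delta 3.
  have ext2 : extremal Delta (q * k + 1) (gunion (copies q (pattern Delta)) (complete 3)).
    apply: extremal_standard => //; [by lia| |by left].
    apply: fits_small; first by rewrite card_complete.
      by apply: degrees_inW (@degrees_in_complete 3) _ _; rewrite // D3.
    by rewrite degree_sum_complete D3.
  have := unique_card uniq ext1 ext2; rewrite card1 card_gunion card_copies.
  by rewrite card_complete D3; lia.
have [|X [cX dX sX]] := @ex_near_regular Delta; first by lia.
have dX1 : degrees_in 1 Delta X by apply: degrees_inW dX _ _; lia.
have [fP _] := fits_pattern D_gt0.
have ext2 : extremal Delta (q * k + 1) (gunion (copies q.-1 (pattern Delta)) X).
  apply: extremal_fits => //; first by lia.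
    have [||x dx] := dense_max_degree _ _ dX1 sX; first by rewrite cX.
      by apply/andP; split; [|rewrite uphalf_half]; lia.
    by exists (inr x); rewrite degree_inr.
  have fX : fits Delta k.+1 (Delta * k.+1 + Delta./2) X by apply: fits_small; rewrite ?cX.
  have := fits_gunion (fits_copies q.-1 fP) fX.
  have -> : q.-1 * k + k.+1 = q * k + 1 by case: (q) q_gt0 => // q' _; rewrite mulSn /=; lia.
  apply: (fits_extremal_size lt_r erefl).
  by case: (q) q_gt0 => // q' _; rewrite mulSn mulnS /= -/k; lia.
have := unique_card uniq ext1 ext2; rewrite card1 card_gunion card_copies cX.
have cP : k.*2 < #|pattern Delta|.
  rewrite /pattern; case: ifPn => [/andP[oD _]|eD]; last by rewrite card_complete /k; lia.
  rewrite card_gcompl card_gunion card_copies card_gcompl card_gunion !card_complete -/k.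
  by lia.
rewrite mul1n; move: cP; move: #|pattern Delta| => c cP.
by case: (q) q_gt0 => // q' _; rewrite mulSn succnK -/k; lia.
Qed.

Theorem theorem5 (Delta nu : nat) (Delta_gt0 : 0 < Delta) (nu_gt0 : 0 < nu) :
  unique_up_to_iso (extremal Delta nu) <-> (uphalf Delta %| nu \/ nu = 1).
Proof.
have k_gt0 : 0 < uphalf Delta by rewrite uphalf_half; lia.
split=> [uniq|uniq_case].
  have [kn|kn] := boolP (uphalf Delta %| nu); [by left | right].
  have [nu_gt1|] := ltnP 1 nu; last by lia.
  rewrite (divn_eq nu (uphalf Delta)) in uniq.
  case: (extremal_not_unique _ _ _ uniq) => //; last by rewrite -divn_eq.
  by rewrite ltn_mod k_gt0 andbT lt0n.
have [/dvdnP[q nuE]|k_ndvd] := boolP (uphalf Delta %| nu).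
  have q_gt0 : 0 < q by move: nu_gt0; rewrite nuE; case: (q).
  rewrite nuE; exists (copies q (pattern Delta)); last first.
    by move=> H; apply: extremal_copies.
  have [fP [p dp]] := fits_pattern Delta_gt0.
  apply: extremal_fits => //; first by rewrite -nuE.
    case: q q_gt0 {nuE} => // q _; exists (inl p).
    by rewrite (@degree_inl (pattern Delta)).
  have := fits_copies q fP; rewrite /extremal_size mulnK //.
  by rewrite mulnDr mulnCA.
have nu1 : nu = 1 by case: uniq_case k_ndvd => [->|].
have k_neq1 : uphalf Delta != 1 by apply: contraNneq k_ndvd => ->; apply: dvd1n.
have D_gt2 : 2 < Delta by move: k_neq1 k_gt0; rewrite uphalf_half; lia.
rewrite nu1; exists (biclique 1 Delta); last by move=> H; apply: extremal_star.
apply: extremal_fits => //; first exact: biclique_max_degree.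
rewrite /extremal_size divn_small ?muln1 ?addn0; last by lia.
by rewrite -[X in fits _ _ X]mul1n; apply: fits_biclique.
Qed.
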